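(* Let $f$ and $g$ be real-valued twice differentiable functions of a real variable, let $\widehat{x}=x_1+\varepsilon x_2$ be a dual number with $x_1$ in the domain of the functions involved, and let $f(\widehat{x})$, $g(\widehat{x})$ be the associated dual valued functions. Then: $$\frac{d}{d\widehat{x}}\bigl(c_1 f(\widehat{x})\pm c_2 g(\widehat{x})\bigr)=c_1\frac{d}{d\widehat{x}}f(\widehat{x})\pm c_2\frac{d}{d\widehat{x}}g(\widehat{x}),\qquad c_1,c_2\in\mathbb{R};$$ $$\frac{d}{d\widehat{x}}\bigl(f(\widehat{x})\cdot g(\widehat{x})\bigr)=\Bigl(\frac{d}{d\widehat{x}}f(\widehat{x})\Bigr)g(\widehat{x})+f(\widehat{x})\frac{d}{d\widehat{x}}g(\widehat{x});$$ $$\frac{d}{d\widehat{x}}\left(\frac{f(\widehat{x})}{g(\widehat{x})}\right)=\frac{\bigl(\frac{d}{d\widehat{x}}f(\widehat{x})\bigr)g(\widehat{x})-f(\widehat{x})\frac{d}{d\widehat{x}}g(\widehat{x})}{[g(\widehat{x})]^2},\qquad g(x_1)\neq 0;$$ $$\frac{d}{d\widehat{x}}f(g(\widehat{x}))=f'(g(\widehat{x}))\,\frac{d}{d\widehat{x}}g(\widehat{x}),$$ where in the last formula $f$ is defined and twice differentiable at the values of $g$.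
   Context: A dual number is $\widehat{x}=x_1+\varepsilon x_2$ with $x_1,x_2\in\mathbb{R}$ and $\varepsilon^2=0$; dual numbers form the commutative ring $\mathbb{R}[\varepsilon]/(\varepsilon^2)$, and $\widehat{y}=y_1+\varepsilon y_2$ is invertible iff $y_1\ne0$, with $1/\widehat{y}=1/y_1-\varepsilon y_2/y_1^2$. A differentiable real function $f$ (on an open subset of $\mathbb{R}$) is extended to dual numbers by $f(\widehat{x})=f(x_1)+\varepsilon x_2 f'(x_1)$; this is called a dual valued function. In particular $f(g(\widehat{x}))$ means $f$ evaluated in this way at the dual number $g(\widehat{x})=g(x_1)+\varepsilon x_2 g'(x_1)$, and $f'(g(\widehat{x}))$ means the dual extension of $f'$ evaluated at $g(\widehat{x})$. The dual derivative is $$\frac{d}{d\widehat{x}}f(\widehat{x})=\frac{\partial}{\partial x_1}\bigl(f(x_1)+\varepsilon x_2 f'(x_1)\bigr)=f'(x_1)+\varepsilon x_2 f''(x_1),$$ and in general $\frac{d}{d\widehat{x}}$ acts on a function of $(x_1,x_2)$ with dual values as $\frac{\partial}{\partial x_1}$, applied to the real and dual parts separately. *)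

(* Defs.v *)
From HB Require Import structures.
From mathcomp Require Import all_boot all_order all_algebra.
From mathcomp Require Import all_classical all_reals all_analysis.
From mathcomp Require Import ring.

Set Implicit Arguments.
Unset Strict Implicit.
Unset Printing Implicit Defensive.

Import Order.TTheory GRing.Theory Num.Theory.
Import numFieldNormedType.Exports.

Local Open Scope classical_set_scope.
Local Open Scope ring_scope.

Record dnum (R : Type) : Type := Dnum { re : R; du : R }.

Definition dnum_pair (R : Type) (x : dnum R) : R * R := (re x, du x).
Definition pair_dnum (R : Type) (p : R * R) : dnum R := Dnum p.1 p.2.

Lemma dnum_pairK (R : Type) : cancel (@dnum_pair R) (@pair_dnum R).
Proof. by case. Qed.

HB.instance Definition _ (R : choiceType) :=
  Choice.copy (dnum R) (can_type (@dnum_pairK R)).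

Section DualRing.
Variable R : fieldType.
Implicit Types x y z : dnum R.

Lemma dnumP x y : re x = re y -> du x = du y -> x = y.
Proof. by case: x y => [a b] [c d] /= -> ->. Qed.

Definition dzero : dnum R := Dnum 0 0.
Definition dopp x := Dnum (- re x) (- du x).
Definition dadd x y := Dnum (re x + re y) (du x + du y).

Lemma daddA : associative dadd.
Proof. by move=> x y z; apply: dnumP => /=; ring. Qed.
Lemma daddC : commutative dadd.
Proof. by move=> x y; apply: dnumP => /=; ring. Qed.
Lemma dadd0 : left_id dzero dadd.
Proof. by move=> x; apply: dnumP => /=; ring. Qed.
Lemma daddN : left_inverse dzero dopp dadd.
Proof. by move=> x; apply: dnumP => /=; ring. Qed.

HB.instance Definition _ :=
  GRing.isZmodule.Build (dnum R) daddA daddC dadd0 daddN.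

Definition dunity : dnum R := Dnum 1 0.
Definition dmul x y := Dnum (re x * re y) (re x * du y + du x * re y).

Lemma dmulA : associative dmul.
Proof. by move=> x y z; apply: dnumP => /=; ring. Qed.
Lemma dmulC : commutative dmul.
Proof. by move=> x y; apply: dnumP => /=; ring. Qed.
Lemma dmul1 : left_id dunity dmul.
Proof. by move=> x; apply: dnumP => /=; ring. Qed.
Lemma dmulDl : left_distributive dmul dadd.
Proof. by move=> x y z; apply: dnumP => /=; ring. Qed.
Lemma dunity_neq0 : dunity != dzero.
Proof. by apply/eqP => -[/eqP]; rewrite oner_eq0. Qed.

HB.instance Definition _ := GRing.Zmodule_isComNzRing.Build (dnum R)
  dmulA dmulC dmul1 dmulDl dunity_neq0.

Definition dunit : {pred dnum R} := fun x => re x != 0.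

(* Non-units are mapped to themselves, as unitRingType requires. *)
Definition dinv x :=
  if re x == 0 then x else Dnum (re x)^-1 (- (du x / re x ^+ 2)).

Lemma dmulV : {in dunit, left_inverse 1 dinv *%R}.
Proof.
move=> x; rewrite /dinv -topredE /= /dunit => x0; rewrite (negPf x0).
by apply: dnumP => /=; field.
Qed.

Lemma dunitP x y : y * x = 1 -> dunit x.
Proof.
move=> /(congr1 (@re R)) /= yx1; apply/eqP => x0.
by move: yx1; rewrite x0 mulr0 => /esym/eqP; rewrite oner_eq0.
Qed.

Lemma dinv_out : {in [predC dunit], dinv =1 id}.
Proof. by move=> x; rewrite !inE /dinv -topredE /= /dunit negbK => ->. Qed.

HB.instance Definition _ := GRing.ComNzRing_hasMulInverse.Build (dnum R)
  dmulV dunitP dinv_out.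

Definition dscale (c : R) x := Dnum (c * re x) (c * du x).

Lemma dscaleA a b x : dscale a (dscale b x) = dscale (a * b) x.
Proof. by apply: dnumP => /=; ring. Qed.
Lemma dscale1 : left_id 1 dscale.
Proof. by move=> x; apply: dnumP => /=; ring. Qed.
Lemma dscaleDr : right_distributive dscale +%R.
Proof. by move=> c x y; apply: dnumP => /=; ring. Qed.
Lemma dscaleDl x : {morph dscale^~ x : a b / a + b}.
Proof. by move=> a b; apply: dnumP => /=; ring. Qed.

HB.instance Definition _ := GRing.Zmodule_isLmodule.Build R (dnum R)
  dscaleA dscale1 dscaleDr dscaleDl.

Lemma dscaleAl (c : R) x y : c *: (x * y) = (c *: x) * y.
Proof. by apply: dnumP => /=; ring. Qed.

HB.instance Definition _ := GRing.Lmodule_isLalgebra.Build R (dnum R) dscaleAl.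
HB.instance Definition _ := GRing.Lalgebra_isComAlgebra.Build R (dnum R).

Lemma dunitE x : (x \is a GRing.unit) = (re x != 0).
Proof. by []. Qed.

Lemma dinvE x : re x != 0 -> x^-1 = Dnum (re x)^-1 (- (du x / re x ^+ 2)).
Proof. by move=> x0; rewrite /GRing.inv /= /dinv (negPf x0). Qed.

End DualRing.

Section DualCalculus.
Variable R : realType.

(* Real functions are total; only their values on the open set U matter. *)
Definition twice_derivable_on (U : set R) (f : R -> R) : Prop :=
  forall t, U t -> derivable f t 1 /\ derivable (derive1 f) t 1.

Definition dext (f : R -> R) (x : dnum R) : dnum R :=
  Dnum (f (re x)) (du x * derive1 f (re x)).

(* A dual valued function restricted to the line where the dual part of the
   argument is frozen to that of x, so that differentiating it at re x is
   taking the partial derivative with respect to the real part. *)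
Definition re_slice (F : dnum R -> dnum R) (x : dnum R) (t : R) : dnum R :=
  F (Dnum t (du x)).

Definition dderivable (F : dnum R -> dnum R) (x : dnum R) : Prop :=
  derivable (fun t => re (re_slice F x t)) (re x) 1 /\
  derivable (fun t => du (re_slice F x t)) (re x) 1.

Definition dderive (F : dnum R -> dnum R) (x : dnum R) : dnum R :=
  Dnum (derive1 (fun t => re (re_slice F x t)) (re x))
       (derive1 (fun t => du (re_slice F x t)) (re x)).

Lemma dderivable_dext (U : set R) (f : R -> R) (x : dnum R) :
  twice_derivable_on U f -> U (re x) -> dderivable (dext f) x.
Proof.
move=> fU /fU[df ddf]; split => //=.
exact: derivableZ.
Qed.

Lemma dderive_dext (U : set R) (f : R -> R) (x : dnum R) :
  twice_derivable_on U f -> U (re x) ->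
  dderive (dext f) x =
    Dnum (derive1 f (re x)) (du x * derive1 (derive1 f) (re x)).
Proof.
move=> fU /fU[df ddf]; apply: dnumP => //=.
by rewrite [LHS]derive1E (deriveZ (du x) ddf) -derive1E.
Qed.

End DualCalculus.

(* Main.v *)
Require Import Defs.
From mathcomp Require Import all_boot all_order all_algebra.
From mathcomp Require Import all_classical all_reals all_analysis.
From mathcomp Require Import ring.

Set Implicit Arguments.
Unset Strict Implicit.
Unset Printing Implicit Defensive.

Import GRing.Theory.
Import numFieldNormedType.Exports.
Local Open Scope classical_set_scope.
Local Open Scope ring_scope.

(** Freeze the dual part of the argument at that of [x].  The dual derivative
    is then an ordinary derivative of a curve [t |-> a t + e * b t] in the
    two-dimensional algebra of dual numbers, and addition, multiplication and
    inversion of such curves are rational in the coordinates [a] and [b].  The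
    linearity, product and quotient rules therefore hold for arbitrary dual
    valued functions, by the one-variable calculus of [a] and [b] followed by an
    algebraic identity in each coordinate: [is_dderiveD], [is_dderiveB],
    [is_dderiveZ], [is_dderiveM], [is_dderiveV].

    The chain rule [is_dderive_dext_comp] is the one place where second
    derivatives of the outer function enter.  Along a curve, the extension of
    [f] is [f a + e * (b * f' a)], whose derivative is
    [f' a * a' + e * (b' * f' a + b * (f'' a * a'))], and this is the dual
    product of [f' a + e * (b * f'' a)] with [a' + e * b'].  Composing with the
    identity curve gives the derivative of [dext f] itself, so that the theorem
    is obtained by applying these rules to [dext f] and [dext g]. *)

(** Differentiability and the value of the dual derivative are bundled, as in
    [is_derive], so that the rules below compose without restating the
    differentiability side conditions. *)
Definition is_dderive (R : realType) (F : dnum R -> dnum R) (x D : dnum R) :=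
  is_derive (re x) (1 : R) (fun t => re (re_slice F x t)) (re D) /\
  is_derive (re x) (1 : R) (fun t => du (re_slice F x t)) (du D).

Section DualDerivativeRules.
Variable R : realType.
Implicit Types (F G : dnum R -> dnum R) (x D E : dnum R) (f : R -> R).

Lemma is_dderiveE F x D :
  is_dderive F x D -> dderivable F x /\ dderive F x = D.
Proof.
move=> [[? Da] [? Db]]; split; first by [].
by apply: dnumP; rewrite /= derive1E.
Qed.

Lemma re_slice_id F x : re_slice F x (re x) = F x.
Proof. by case: x. Qed.

Lemma is_derive_derive1 f (t : R) :
  derivable f t 1 -> is_derive t (1 : R) f (derive1 f t).
Proof. by move=> df; rewrite derive1E; exact: derivableP. Qed.

Lemma is_dderiveD F G x D E : is_dderive F x D -> is_dderive G x E ->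
  is_dderive (fun y => F y + G y) x (D + E).
Proof. by move=> [Fr Fd] [Gr Gd]; split; exact: is_deriveD. Qed.

Lemma is_dderiveB F G x D E : is_dderive F x D -> is_dderive G x E ->
  is_dderive (fun y => F y - G y) x (D - E).
Proof. by move=> [Fr Fd] [Gr Gd]; split; exact: is_deriveB. Qed.

Lemma is_dderiveZ (c : R) F x D : is_dderive F x D ->
  is_dderive (fun y => c *: F y) x (c *: D).
Proof. by move=> [Fr Fd]; split; exact: is_deriveZ. Qed.

Lemma is_dderiveM F G x D E : is_dderive F x D -> is_dderive G x E ->
  is_dderive (fun y => F y * G y) x (D * G x + F x * E).
Proof.
move=> [Fr Fd] [Gr Gd]; split.
  apply: is_derive_eq (is_deriveM Fr Gr) _.
  by rewrite !re_slice_id /GRing.scale /=; ring.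
apply: is_derive_eq (is_deriveD (is_deriveM Fr Gd) (is_deriveM Fd Gr)) _.
by rewrite !re_slice_id /GRing.scale /=; ring.
Qed.

(** The inverse of a dual number is given by a formula only when its real part
    is nonzero, hence the coordinates of the inverted curve are known near
    [re x] by continuity of the real part, which is enough to differentiate
    there. *)
Lemma is_dderiveV F x D : re (F x) != 0 -> is_dderive F x D ->
  is_dderive (fun y => (F y)^-1) x (- D / F x ^+ 2).
Proof.
move=> Fx0 [Fr Fd].
pose a t := re (re_slice F x t); pose b t := du (re_slice F x t).
have ax0 : a (re x) != 0 by rewrite /a re_slice_id.
have near_inv : \forall t \near re x,
    re_slice (fun y => (F y)^-1) x t = Dnum (a t)^-1 (- (b t / a t ^+ 2)).
  have a_cont : {for re x, continuous a}.
    by apply/differentiable_continuous/derivable1_diffP; case: Fr.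
  near=> t; apply: dinvE; rewrite -/(re_slice F x t) -/(a t).
  by near: t; exact: cvgr_neq0 a_cont ax0.
rewrite expr2; have Fx2 : re (F x * F x) != 0 by rewrite mulf_neq0.
have Va := is_deriveV ax0 Fr.
split.
  apply: (@near_eq_is_derive _ _ _ (fun t => (a t)^-1)).
    by near=> t; rewrite (near near_inv t _).
  apply: is_derive_eq Va _.
  by rewrite dinvE // /a re_slice_id /GRing.scale /=; field.
(* Written as a product of inverses so that the product rule applies. *)
apply: (@near_eq_is_derive _ _ _ (fun t => - (b t * ((a t)^-1 * (a t)^-1)))).
  by near=> t; rewrite (near near_inv t _) //= expr2 invfM.
apply: is_derive_eq (is_deriveN (is_deriveM Fd (is_deriveM Va Va))) _.
by rewrite dinvE // mulrfctE /a /b !re_slice_id /GRing.scale /=; field.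
Unshelve. all: by end_near.
Qed.

Lemma is_dderive_id x : is_dderive id x 1.
Proof. by split; [exact: is_derive_id | exact: is_derive_cst]. Qed.

Lemma is_dderive_dext_comp f G x E :
  derivable f (re (G x)) 1 -> derivable (derive1 f) (re (G x)) 1 ->
  is_dderive G x E ->
  is_dderive (fun y => dext f (G y)) x (dext (derive1 f) (G x) * E).
Proof.
rewrite -{1 2}(re_slice_id G x).
move=> /is_derive_derive1 df /is_derive_derive1 ddf [Gr Gd]; split.
  apply: is_derive_eq (is_derive1_comp df Gr) _.
  by rewrite re_slice_id.
apply: is_derive_eq (is_deriveM Gd (is_derive1_comp ddf Gr)) _.
by rewrite !re_slice_id /GRing.scale /= re_slice_id; ring.
Qed.

Lemma is_dderive_dext f x :
  derivable f (re x) 1 -> derivable (derive1 f) (re x) 1 ->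
  is_dderive (dext f) x (dderive (dext f) x).
Proof.
move=> df ddf; have dF := is_dderive_dext_comp df ddf (is_dderive_id x).
by have [_ ->] := is_dderiveE dF.
Qed.

End DualDerivativeRules.

Theorem theorem3p1 (R : realType) (U V : set R) (f g : R -> R) (x : dnum R)
    (oU : open U) (oV : open V)
    (fU : twice_derivable_on U f) (gV : twice_derivable_on V g) :
  (U (re x) -> V (re x) -> forall c1 c2 : R,
     (dderivable (fun y => c1 *: dext f y + c2 *: dext g y) x /\
      dderive (fun y => c1 *: dext f y + c2 *: dext g y) x =
        c1 *: dderive (dext f) x + c2 *: dderive (dext g) x) /\
     (dderivable (fun y => c1 *: dext f y - c2 *: dext g y) x /\
      dderive (fun y => c1 *: dext f y - c2 *: dext g y) x =
        c1 *: dderive (dext f) x - c2 *: dderive (dext g) x)) /\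
  (U (re x) -> V (re x) ->
     dderivable (fun y => dext f y * dext g y) x /\
     dderive (fun y => dext f y * dext g y) x =
       dderive (dext f) x * dext g x + dext f x * dderive (dext g) x) /\
  (U (re x) -> V (re x) -> g (re x) != 0 ->
     dderivable (fun y => dext f y / dext g y) x /\
     dderive (fun y => dext f y / dext g y) x =
       (dderive (dext f) x * dext g x - dext f x * dderive (dext g) x)
         / dext g x ^+ 2) /\
  (V (re x) -> U (g (re x)) ->
     dderivable (fun y => dext f (dext g y)) x /\
     dderive (fun y => dext f (dext g y)) x =
       dext (derive1 f) (dext g x) * dderive (dext g) x).
Proof.
have dF : U (re x) -> is_dderive (dext f) x (dderive (dext f) x).
  by move=> /fU[df ddf]; exact: is_dderive_dext.
have dG : V (re x) -> is_dderive (dext g) x (dderive (dext g) x).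
  by move=> /gV[dg ddg]; exact: is_dderive_dext.
split; [|split; [|split]].
- move=> /dF {}dF /dG {}dG c1 c2; split; apply: is_dderiveE.
    by apply: is_dderiveD; exact: is_dderiveZ.
  by apply: is_dderiveB; exact: is_dderiveZ.
- by move=> /dF {}dF /dG {}dG; apply: is_dderiveE; exact: is_dderiveM.
- move=> /dF {}dF /dG {}dG gx0; apply: is_dderiveE.
  have gxU : dext g x \is a GRing.unit by rewrite dunitE.
  (* The quotient rule in the form given by the product of [dext f] with the
     inverse of [dext g]. *)
  have -> : (dderive (dext f) x * dext g x - dext f x * dderive (dext g) x)
      / dext g x ^+ 2
    = dderive (dext f) x * (dext g x)^-1
      + dext f x * (- dderive (dext g) x / dext g x ^+ 2).
    by rewrite mulrBl expr2 invrM // [_ * ((_)^-1 * _)]mulrA mulrK //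
      mulNr mulrN mulrA.
  by apply: is_dderiveM; [|exact: is_dderiveV].
- move=> /dG {}dG /fU[df ddf]; apply: is_dderiveE.
  exact: is_dderive_dext_comp.
Qed.
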